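(* Let $C=\mathbb{K}[x,y,z_1,\dots,z_k]/(h_1,\dots,h_l)$ be a domain, where for each $1\le j\le l$ there is a polynomial $\overline{h}_j$ in $k+2$ variables with $h_j(x,y,z_1,\dots,z_k)=\overline{h}_j(xy^2,y,z_1,\dots,z_k)$. Suppose $\delta$ is a locally nilpotent derivation of $C$ such that $\delta(y)=0$; $\delta(x)$ is the class of a polynomial $g(y,z_1,\dots,z_k)\in\mathbb{K}[y,z_1,\dots,z_k]$ and is not divisible by $y$ in $C$; and for each $1\le j\le k$ the element $\delta(z_j)$ lies in the subalgebra of $C$ generated by $y,z_1,\dots,z_k$ and is divisible by $y^2$ in this subalgebra. Put $\widetilde{h}_j(x,y,z_1,\dots,z_k)=\overline{h}_j(xy,y,z_1,\dots,z_k)$ and assume that $\widetilde{C}=\mathbb{K}[x,y,z_1,\dots,z_k]/(\widetilde{h}_1,\dots,\widetilde{h}_l)$ is a domain. Let $\widehat{g}(z_1,\dots,z_k)=g(0,z_1,\dots,z_k)$ and $\widehat{h}_j(z_1,\dots,z_k)=\overline{h}_j(0,0,z_1,\dots,z_k)$. Let $Z=\mathrm{Spec}\,C$ and $Y=\mathrm{Spec}\,\widetilde{C}$. If the ideal $(\widehat{g},\widehat{h}_1,\dots,\widehat{h}_l)\subseteq\mathbb{K}[z_1,\dots,z_k]$ is not proper (i.e. equals $\mathbb{K}[z_1,\dots,z_k]$), then $Z\times\mathbb{K}\cong Y\times\mathbb{K}$.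
   Context: $\mathbb{K}$ is an algebraically closed field of characteristic zero. A derivation $\delta$ of a $\mathbb{K}$-algebra $C$ ($\mathbb{K}$-linear, satisfying the Leibniz rule) is locally nilpotent if for each $c\in C$ there is $n$ with $\delta^n(c)=0$. $Z\times\mathbb{K}$ denotes the product with the affine line. *)

(* Defs.v *)
From HB Require Import structures.
From mathcomp Require Import all_boot all_algebra.
From mathcomp Require Export mpoly.
From mathcomp Require Import boolp.

Set Implicit Arguments.
Unset Strict Implicit.
Unset Printing Implicit Defensive.

Import GRing.Theory.
Local Open Scope ring_scope.
Local Open Scope quotient_scope.

Section Ideal.
Variable A : comNzRingType.

Definition in_ideal (hs : seq A) (a : A) : Prop :=
  exists c : 'I_(size hs) -> A, a = \sum_(i < size hs) c i * hs`_i.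

Definition is_proper (hs : seq A) : Prop := ~ in_ideal hs 1.

(* The library's [idealr] is a boolean predicate closed under the ring
   operations and not containing 1, hence the properness argument. *)
Definition ideal_pred (hs : seq A) (_ : is_proper hs) : A -> bool :=
  fun a => `[< in_ideal hs a >].

Lemma ideal_pred_closed hs (hp : is_proper hs) : idealr_closed (ideal_pred hp).
Proof.
split; rewrite ?inE /ideal_pred.
- apply/asboolP; exists (fun=> 0).
  by rewrite big1 // => i _; rewrite mul0r.
- by apply/asboolP.
- move=> a u v /asboolP[c ->] /asboolP[d ->]; apply/asboolP.
  exists (fun i => a * c i + d i).
  rewrite mulr_sumr -big_split /=.
  by apply: eq_bigr => i _; rewrite mulrDl mulrA.
Qed.

HB.instance Definition _ hs (hp : is_proper hs) :=
  isIdealr.Build A (ideal_pred hp) (ideal_pred_closed hp).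

Definition ideal_gen hs (hp : is_proper hs) : idealr A := ideal_pred hp.

End Ideal.

Section QuotientAlgebra.
Variables (K : comNzRingType) (A : comAlgType K).
Variables (hs : seq A) (hp : is_proper hs).

Definition quot_alg : Type := {ideal_quot (ideal_gen hp)}.

HB.instance Definition _ := GRing.ComNzRing.on quot_alg.

Definition cls (a : A) : quot_alg := \pi_{ideal_quot (ideal_gen hp)} a.

Lemma cls_is_zmod_morphism : zmod_morphism cls.
Proof. exact: (raddfB \pi_{ideal_quot (ideal_gen hp)}). Qed.

Lemma cls_is_monoid_morphism : monoid_morphism cls.
Proof.
split; first exact: (rmorph1 \pi_{ideal_quot (ideal_gen hp)}).
exact: (rmorphM \pi_{ideal_quot (ideal_gen hp)}).
Qed.

HB.instance Definition _ :=
  GRing.isZmodMorphism.Build A quot_alg cls cls_is_zmod_morphism.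
HB.instance Definition _ :=
  GRing.isMonoidMorphism.Build A quot_alg cls cls_is_monoid_morphism.

Lemma cls_surj (c : quot_alg) : exists a, c = cls a.
Proof. by exists (repr c); rewrite /cls reprK. Qed.

Lemma cls_eq0 (a : A) : cls a = 0 <-> in_ideal hs a.
Proof.
have -> : (cls a = 0) <-> (cls a = cls 0) by rewrite raddf0.
split=> [/eqP|h]; first by rewrite -Quotient.idealrBE subr0 => /asboolP.
by apply/eqP; rewrite -Quotient.idealrBE subr0; apply/asboolP.
Qed.

Definition quot_scale (k : K) (c : quot_alg) : quot_alg := cls k%:A * c.

Lemma quot_scaleA k l c :
  quot_scale k (quot_scale l c) = quot_scale (k * l) c.
Proof. by rewrite /quot_scale mulrA -rmorphM mulr_algl scalerA. Qed.

Lemma quot_scale1 : left_id 1 quot_scale.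
Proof. by move=> c; rewrite /quot_scale scale1r rmorph1 mul1r. Qed.

Lemma quot_scaleDr : right_distributive quot_scale +%R.
Proof. by move=> k c d; rewrite /quot_scale mulrDr. Qed.

Lemma quot_scaleDl c : {morph quot_scale^~ c : k l / k + l}.
Proof. by move=> k l; rewrite /quot_scale scalerDl rmorphD mulrDl. Qed.

HB.instance Definition _ := GRing.Zmodule_isLmodule.Build K quot_alg
  quot_scaleA quot_scale1 quot_scaleDr quot_scaleDl.

Lemma quot_scaleAl (k : K) (c d : quot_alg) : k *: (c * d) = (k *: c) * d.
Proof. exact: mulrA. Qed.

HB.instance Definition _ :=
  GRing.Lmodule_isLalgebra.Build K quot_alg quot_scaleAl.

Lemma quot_scaleAr (k : K) (c d : quot_alg) : k *: (c * d) = c * (k *: d).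
Proof. exact: mulrCA. Qed.

HB.instance Definition _ :=
  GRing.Lalgebra_isAlgebra.Build K quot_alg quot_scaleAr.

Lemma cls_is_scalable : scalable cls.
Proof. by move=> k a; rewrite -[in LHS]mulr_algl rmorphM. Qed.

HB.instance Definition _ :=
  GRing.isScalable.Build K A quot_alg *:%R cls cls_is_scalable.

End QuotientAlgebra.

Section Derivations.
Variables (K : comNzRingType) (C : comAlgType K).

Definition derivation (d : C -> C) : Prop :=
  linear d /\ forall a b, d (a * b) = d a * b + a * d b.

Definition locally_nilpotent (d : C -> C) : Prop :=
  forall c, exists n, iter n d c = 0.

Definition divides (a c : C) : Prop := exists b, c = a * b.

Definition gen_subalg (S : C -> Prop) (c : C) : Prop :=
  forall B : {pred C}, GRing.subalg_closed B ->
    (forall s, S s -> s \in B) -> c \in B.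

End Derivations.

(* The coordinates of {mpoly K[k.+2]} are numbered x, y, z_1, ..., z_k, those
   of {mpoly K[k.+1]} are y, z_1, ..., z_k, and those of {mpoly K[k]} are
   z_1, ..., z_k. *)
Section Coordinates.
Variables (K : comNzRingType) (k : nat).

Definition Xx : {mpoly K[k.+2]} := 'X_ord0.
Definition Xy : {mpoly K[k.+2]} := 'X_(lift ord0 ord0).
Definition Xz (j : 'I_k) : {mpoly K[k.+2]} := 'X_(lift ord0 (lift ord0 j)).

(* p(u, y, z_1, ..., z_k) *)
Definition subst_x (u : {mpoly K[k.+2]}) (p : {mpoly K[k.+2]}) :
    {mpoly K[k.+2]} :=
  p \mPo [tuple of u :: Xy :: [tuple Xz j | j < k]].

(* g(y, z_1, ..., z_k), seen in K[x, y, z_1, ..., z_k] *)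
Definition of_yz (g : {mpoly K[k.+1]}) : {mpoly K[k.+2]} :=
  g \mPo [tuple of Xy :: [tuple Xz j | j < k]].

(* g(0, z_1, ..., z_k) *)
Definition at_y0 (g : {mpoly K[k.+1]}) : {mpoly K[k]} :=
  g \mPo [tuple of 0 :: [tuple 'X_j | j < k]].

(* p(0, 0, z_1, ..., z_k) *)
Definition at_xy0 (p : {mpoly K[k.+2]}) : {mpoly K[k]} :=
  p \mPo [tuple of 0 :: 0 :: [tuple 'X_j | j < k]].

End Coordinates.
Arguments Xx {K k}.
Arguments Xy {K k}.
Arguments Xz {K k} j.

(* Affine K-schemes are represented by their functors of points on commutative
   K-algebras. [comAlgType] excludes the zero algebra, on which every affine
   scheme has exactly one point. *)
Section Schemes.
Variable K : comNzRingType.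

Record kfunctor := KFunctor {
  points : comAlgType K -> Type;
  pmap : forall R S : comAlgType K, {lrmorphism R -> S} -> points R -> points S;
  pmap_id : forall (R : comAlgType K) (f : {lrmorphism R -> R}),
    f =1 id -> pmap f =1 id;
  pmap_comp : forall (R S T : comAlgType K) (f : {lrmorphism R -> S})
    (g : {lrmorphism S -> T}) (h : {lrmorphism R -> T}),
    h =1 g \o f -> pmap h =1 pmap g \o pmap f
}.

Definition kiso (F G : kfunctor) : Prop :=
  exists eta : forall R : comAlgType K, points F R -> points G R,
    (forall R, bijective (eta R)) /\
    (forall (R S : comAlgType K) (f : {lrmorphism R -> S}) (p : points F R),
       eta S (pmap f p) = pmap f (eta R p)).

Lemma lrmorphism_ext (R S : comAlgType K) (f g : {lrmorphism R -> S}) :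
  f =1 g -> f = g.
Proof.
case: f g => [f cf] [g cg] /= /funext fg; move: cf cg; rewrite /= in fg *.
rewrite fg => -[[a1] [b1] [c1]] [[a2] [b2] [c2]].
by rewrite (Prop_irrelevance a1 a2) (Prop_irrelevance b1 b2)
  (Prop_irrelevance c1 c2).
Qed.

Section Spec.
Variable C : comAlgType K.

Definition spec_map (R S : comAlgType K) (f : {lrmorphism R -> S})
  (p : {lrmorphism C -> R}) : {lrmorphism C -> S} := f \o p.

Lemma spec_map_id (R : comAlgType K) (f : {lrmorphism R -> R}) :
  f =1 id -> spec_map f =1 id.
Proof. by move=> fE p; apply: lrmorphism_ext => c; exact: fE. Qed.

Lemma spec_map_comp (R S T : comAlgType K) (f : {lrmorphism R -> S})
    (g : {lrmorphism S -> T}) (h : {lrmorphism R -> T}) :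
  h =1 g \o f -> spec_map h =1 spec_map g \o spec_map f.
Proof. by move=> hE p; apply: lrmorphism_ext => c; exact: hE. Qed.

Definition Spec : kfunctor := KFunctor spec_map_id spec_map_comp.

End Spec.

Definition affine_line_map (R S : comAlgType K) (f : {lrmorphism R -> S}) :
  R -> S := f.

Lemma affine_line_map_id (R : comAlgType K) (f : {lrmorphism R -> R}) :
  f =1 id -> affine_line_map f =1 id.
Proof. by []. Qed.

Lemma affine_line_map_comp (R S T : comAlgType K) (f : {lrmorphism R -> S})
    (g : {lrmorphism S -> T}) (h : {lrmorphism R -> T}) :
  h =1 g \o f ->
  affine_line_map h =1 affine_line_map g \o affine_line_map f.
Proof. by []. Qed.

Definition affine_line : kfunctor :=
  KFunctor affine_line_map_id affine_line_map_comp.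

Section Product.
Variables F G : kfunctor.

Definition prod_map (R S : comAlgType K) (f : {lrmorphism R -> S})
  (p : points F R * points G R) : points F S * points G S :=
  (pmap f p.1, pmap f p.2).

Lemma prod_map_id (R : comAlgType K) (f : {lrmorphism R -> R}) :
  f =1 id -> prod_map f =1 id.
Proof. by move=> fE [p q]; rewrite /prod_map /= !pmap_id. Qed.

Lemma prod_map_comp (R S T : comAlgType K) (f : {lrmorphism R -> S})
    (g : {lrmorphism S -> T}) (h : {lrmorphism R -> T}) :
  h =1 g \o f -> prod_map h =1 prod_map g \o prod_map f.
Proof.
by move=> hE [p q]; rewrite /prod_map /= !(pmap_comp hE).
Qed.

Definition kprod : kfunctor := KFunctor prod_map_id prod_map_comp.

End Product.
End Schemes.
Arguments affine_line {K}.

(* Main.v *)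
Require Import Defs.
From HB Require Import structures.
From mathcomp Require Import all_boot all_algebra.
From mathcomp Require Import boolp ring.

Set Implicit Arguments.
Unset Strict Implicit.
Unset Printing Implicit Defensive.

Import GRing.Theory.
Local Open Scope ring_scope.

(** Write [A] for the algebra of [htilde] and [C] for that of [h].  The
    morphism [iota : A -> C] sending [x] to [x y] turns [C] into [A[x/y]], the
    affine modification of [A] with centre [x = y = 0].  Hence [C[t]] is the
    affine modification of [A[t]] with centre [x = y = 0], whereas the
    modification of [A[t]] with centre [t = y = 0] is [A[t/y]], which is again
    a polynomial ring over [A].  So it suffices to find an automorphism of
    [A[t]] that fixes [y] and exchanges the two centres, that is, maps [x] into
    the ideal [(y, t)] and whose inverse maps [t] into [(y, x)].

    The derivation provides it.  On [A], [delta] takes values divisible by [y],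
    and [D = delta / y] is a locally nilpotent derivation that modulo [y] kills
    [z] and maps [x] to [g].  As the ideal of the hypothesis is full, [g] has
    modulo [y] an inverse [q] that is a polynomial in [z].  Then
    [exp(t D)] maps [x] to [x + t g] modulo [y], and following it by
    [t |-> t - q x] gives [x + (t - q x) g], which is [t g] modulo [y]; the
    inverse automorphism maps [t] to [exp(- t D)(t + q x)], which is [q x]
    modulo [y].  Rescaling [t] to [y t], one obtains two mutually inverse
    morphisms between [C[t]] and [A[t]]; this is [modification_cylinder], and
    [cylinder_iso] turns them into an isomorphism of functors of points.

    All this requires [y] to be regular in [C].  As [C] is a domain, the
    remaining case is [y = 0] in [C]; then [y = 0] in [A] too ([y0_descends]),
    and [A] and [C] are the same algebra. *)

(** * Ring morphisms out of polynomial rings *)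

Section PolyEval.
Variables (A S : comNzRingType) (f : {rmorphism A -> S}) (s : S).

Definition poly_eval : {poly A} -> S :=
  horner_morph (fun a => mulrC s (f a)).

HB.instance Definition _ := GRing.RMorphism.on poly_eval.

Lemma poly_evalC a : poly_eval a%:P = f a.
Proof. exact: horner_morphC. Qed.

Lemma poly_evalX : poly_eval 'X = s.
Proof. exact: horner_morphX. Qed.

End PolyEval.

Lemma poly_morph_ext (A S : comNzRingType) (f g : {rmorphism {poly A} -> S}) :
  (forall a, f a%:P = g a%:P) -> f 'X = g 'X -> f =1 g.
Proof.
move=> fgC fgX; elim/poly_ind=> [|p c IHp]; first by rewrite !rmorph0.
by rewrite !rmorphD !rmorphM /= IHp fgC fgX.
Qed.

Lemma mpoly_closed_ind (K : comNzRingType) (n : nat)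
    (P : {mpoly K[n]} -> Prop) :
  (forall c, P c%:MP) -> (forall i, P 'X_i) ->
  (forall p q, P p -> P q -> P (p + q)) ->
  (forall p q, P p -> P q -> P (p * q)) ->
  forall p, P p.
Proof.
move=> PC PX PD PM; apply: mpolyind => [|c m p _ _ Pp].
  by rewrite -mpolyC0.
apply: PD Pp; rewrite -mul_mpolyC; apply: (PM) => //.
rewrite mpolyXE_id; apply: (big_ind P) => // [|i _]; first by rewrite -mpolyC1.
elim: (m i) => [|e IHe]; first by rewrite expr0 -mpolyC1.
by rewrite exprS; apply: PM.
Qed.

Lemma mpoly_morph_ext (K S : comNzRingType) (n : nat)
    (f g : {rmorphism {mpoly K[n]} -> S}) :
  (forall c, f c%:MP = g c%:MP) -> (forall i, f 'X_i = g 'X_i) -> f =1 g.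
Proof.
move=> fgC fgX; elim/mpoly_closed_ind=> [//|//|p q IHp IHq|p q IHp IHq].
- by rewrite !rmorphD /= IHp IHq.
- by rewrite !rmorphM /= IHp IHq.
Qed.

(** * Congruences *)

Definition eqmod (S : comNzRingType) (d a b : S) := exists w, a = b + d * w.

Section Congruence.
Variables (S : comNzRingType) (d : S).

Lemma eqmod_refl a : eqmod d a a.
Proof. by exists 0; rewrite mulr0 addr0. Qed.

Lemma eqmodD a b a' b' : eqmod d a b -> eqmod d a' b' ->
  eqmod d (a + a') (b + b').
Proof. by move=> [w ->] [w' ->]; exists (w + w'); ring. Qed.

Lemma eqmodM a b a' b' : eqmod d a b -> eqmod d a' b' ->
  eqmod d (a * a') (b * b').
Proof.
by move=> [w ->] [w' ->]; exists (w * b' + b * w' + d * w * w'); ring.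
Qed.

Lemma eqmod_sum0 n (F : 'I_n -> S) : (forall i, eqmod d (F i) 0) ->
  eqmod d (\sum_i F i) 0.
Proof.
move=> F0; elim/big_ind: _ => [|a b a0 b0|//]; first exact: eqmod_refl.
by rewrite -[0]addr0; apply: eqmodD.
Qed.

Lemma eqmod_mull0 a b : eqmod d b 0 -> eqmod d (a * b) 0.
Proof. by move=> [w ->]; exists (a * w); ring. Qed.

Lemma eqmod_mpoly (K : comNzRingType) (n : nat)
    (f g : {rmorphism {mpoly K[n]} -> S}) :
  (forall c, f c%:MP = g c%:MP) -> (forall i, eqmod d (f 'X_i) (g 'X_i)) ->
  forall p, eqmod d (f p) (g p).
Proof.
move=> fgC fgX; elim/mpoly_closed_ind=> [c|//|p q IHp IHq|p q IHp IHq].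
- by rewrite fgC; apply: eqmod_refl.
- by rewrite !rmorphD; apply: eqmodD.
- by rewrite !rmorphM; apply: eqmodM.
Qed.

End Congruence.

Lemma eqmod_poly (A : comNzRingType) (d : A) (p q : {poly A}) :
  (forall i, eqmod d p`_i q`_i) -> eqmod d%:P p q.
Proof.
move=> /choice[w pq]; exists (\poly_(i < maxn (size p) (size q)) w i).
apply/polyP=> i; rewrite coefD coefCM coef_poly.
case: ltnP => [_|]; first exact: pq.
by rewrite geq_max mulr0 addr0 => /andP[pi qi]; rewrite !nth_default.
Qed.

(** * Scalars and derivations *)

(** The scalars of [A] as a map into [A]: under [%:P], a bare [k%:A] would
    select the ring of coefficients through the module structure of [A]. *)
Definition alg_const (K : comNzRingType) (A : comAlgType K) (k : K) : A := k%:A.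

HB.instance Definition _ (K : comNzRingType) (A : comAlgType K) :=
  GRing.RMorphism.copy (@alg_const K A) (in_alg A).

Lemma morph_scalable (K : comNzRingType) (A B : comAlgType K)
    (f : {rmorphism A -> B}) :
  (forall k : K, f (alg_const A k) = alg_const B k) -> scalable f.
Proof. by move=> fK k a; rewrite -mulr_algl rmorphM [f _]fK mulr_algl. Qed.

Lemma lrmorph_const (K : comNzRingType) (A B : comAlgType K)
    (f : {lrmorphism A -> B}) k : f (alg_const A k) = alg_const B k.
Proof. by rewrite /alg_const linearZ /= rmorph1. Qed.

Lemma alg_morph_of_rmorph (K : comNzRingType) (A B : comAlgType K)
    (f : {rmorphism A -> B}) :
  (forall k : K, f (alg_const A k) = alg_const B k) ->
  exists g : {lrmorphism A -> B}, g =1 f.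
Proof.
move=> /morph_scalable fK.
pose F := HB.pack_for {lrmorphism A -> B} (GRing.RMorphism.sort f)
  (GRing.isZmodMorphism.Build A B f (rmorphB f))
  (GRing.isMonoidMorphism.Build A B f (rmorphism_monoidP f))
  (GRing.isScalable.Build K A B *:%R f fK).
by exists F.
Qed.

Lemma gen_subalg_image (K : comNzRingType) (A B : comAlgType K)
    (f : {lrmorphism A -> B}) (G : B -> Prop) b :
  (forall s, G s -> exists a, s = f a) -> gen_subalg G b -> exists a, b = f a.
Proof.
move=> Gf Gb; pose P : {pred B} := fun c => `[< exists a, c = f a >].
suff /asboolP : b \in P by [].
apply: Gb => [|s /Gf s_im]; last exact/asboolP.
split=> [|c u v|u v]; first by apply/asboolP; exists 1; rewrite rmorph1.
- move=> /asboolP[a ->] /asboolP[a' ->].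
  by apply/asboolP; exists (c *: a + a'); rewrite linearP.
- move=> /asboolP[a ->] /asboolP[a' ->].
  by apply/asboolP; exists (a * a'); rewrite rmorphM.
Qed.

Section Derivation.
Variables (K : comNzRingType) (A : comAlgType K) (D : {linear A -> A}).
Hypothesis DM : forall a b : A, D (a * b) = D a * b + a * D b.

Lemma derivation1 : D 1 = 0.
Proof.
have := DM 1 1; rewrite !mul1r mulr1 -[LHS]addr0 => /addrI /esym; exact.
Qed.

Lemma derivation_const k : D (alg_const A k) = 0.
Proof. by rewrite linearZ /= derivation1 scaler0. Qed.

Lemma derivation_eqmod0 (n : nat) (f : {rmorphism {mpoly K[n]} -> A}) (y : A) :
  (forall c, f c%:MP = alg_const A c) ->
  (forall i, eqmod y (D (f 'X_i)) 0) -> forall p, eqmod y (D (f p)) 0.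
Proof.
move=> fC fX; elim/mpoly_closed_ind=> [c|//|p q IHp IHq|p q IHp IHq].
- by rewrite fC derivation_const; apply: eqmod_refl.
- by rewrite rmorphD linearD -[0]addr0; apply: eqmodD.
rewrite rmorphM DM; case: IHp IHq => [u ->] [v ->].
by exists (u * f q + f p * v); ring.
Qed.

End Derivation.

(** * The exponential of a locally nilpotent derivation *)

Section Exponential.
Variables (K : fieldType) (A : comAlgType K) (D : {linear A -> A}).
Hypothesis charK0 : [pchar K] =i pred0.
Hypothesis DM : forall a b : A, D (a * b) = D a * b + a * D b.
Hypothesis Dnil : locally_nilpotent D.

Lemma natr_regular (a : A) n : a *+ n.+1 = 0 -> a = 0.
Proof.
move/eqP; rewrite -scaler_nat scaler_eq0 ((pcharf0P K).1 charK0) /=.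
by move/eqP.
Qed.

Lemma iter_derivation0 n : iter n D 0 = 0.
Proof. by elim: n => // n /= ->; rewrite linear0. Qed.

Lemma iter_derivation_linear n k a b :
  iter n D (k *: a + b) = k *: iter n D a + iter n D b.
Proof. by elim: n => //= n ->; rewrite linearP. Qed.

(** [exp(t D)], with [t] the polynomial variable: the sum is cut at an order
    that kills [a]. *)
Definition exp_der (a : A) : {poly A} :=
  \poly_(n < sval (cid (Dnil a))) ((n`!%:R : K)^-1 *: iter n D a).

Lemma coef_exp_der a n : (exp_der a)`_n = (n`!%:R : K)^-1 *: iter n D a.
Proof.
rewrite coef_poly; case: cid => m /= Dm0; case: ltnP => // /subnK <-.
by rewrite iterD Dm0 iter_derivation0 scaler0.
Qed.

Lemma deriv_exp_der a : (exp_der a)^`() = exp_der (D a).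
Proof.
apply/polyP=> n; rewrite coef_deriv !coef_exp_der -iterSr -scaler_nat scalerA.
rewrite factS natrM invfM mulrA mulfV ?mul1r //.
by rewrite ((pcharf0P K).1 charK0).
Qed.

Definition coefwise_der (p : {poly A}) : {poly A} := map_poly D p.

Lemma coef_coefwise_der p i : (coefwise_der p)`_i = D p`_i.
Proof. by rewrite coef_map. Qed.

Lemma coefwise_derD p q :
  coefwise_der (p + q) = coefwise_der p + coefwise_der q.
Proof. by apply/polyP=> i; rewrite !(coefD, coef_coefwise_der) linearD. Qed.

Lemma coefwise_derC c : coefwise_der c%:P = (D c)%:P.
Proof.
apply/polyP=> i; rewrite coef_coefwise_der !coefC.
by case: eqP; rewrite ?linear0.
Qed.

Lemma coefwise_derX : coefwise_der 'X = 0.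
Proof.
apply/polyP=> i; rewrite coef_coefwise_der coefX coef0.
by case: (i == 1%N); rewrite ?(derivation1 DM) ?linear0.
Qed.

Lemma coefwise_der_exp a : coefwise_der (exp_der a) = exp_der (D a).
Proof.
apply/polyP=> n.
rewrite coef_coefwise_der !coef_exp_der -iterSr iterS.
by rewrite linearZ.
Qed.

Lemma coefwise_derM p q :
  coefwise_der (p * q) = coefwise_der p * q + p * coefwise_der q.
Proof.
apply/polyP=> n; rewrite coefD coef_coefwise_der !coefM raddf_sum -big_split /=.
by apply: eq_bigr => i _; rewrite !coef_coefwise_der DM.
Qed.

(** In characteristic zero, the equation [p' = D p] determines the coefficients
    of [p] one after the other from the constant one.  Multiplicativity of the
    exponential follows from it, without the binomial Leibniz formula. *)
Lemma poly_flow_unique (p q : {poly A}) :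
  p^`() = coefwise_der p -> q^`() = coefwise_der q -> p`_0 = q`_0 -> p = q.
Proof.
move=> pD qD pq0; apply/polyP; elim=> // n IHn.
apply/eqP; rewrite -subr_eq0; apply/eqP/(@natr_regular _ n).
by rewrite mulrnBl -!coef_deriv pD qD !coef_coefwise_der IHn subrr.
Qed.

Lemma exp_der_zmod_morphism : zmod_morphism exp_der.
Proof.
move=> a b; apply/polyP=> n; rewrite coefB !coef_exp_der addrC -scaleN1r.
by rewrite iter_derivation_linear scalerDr scaleN1r scalerN addrC.
Qed.

Lemma coef0_exp_der a : (exp_der a)`_0 = a.
Proof. by rewrite coef_exp_der invr1 scale1r. Qed.

Lemma exp_der_const a : D a = 0 -> exp_der a = a%:P.
Proof.
move=> Da0; apply/polyP=> -[|n]; first by rewrite coef0_exp_der coefC.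
by rewrite coef_exp_der coefC iterSr Da0 iter_derivation0 scaler0.
Qed.

Lemma exp_der_monoid_morphism : monoid_morphism exp_der.
Proof.
split=> [|a b]; first by rewrite exp_der_const ?(derivation1 DM).
apply: poly_flow_unique; first by rewrite deriv_exp_der coefwise_der_exp.
  by rewrite derivM coefwise_derM !deriv_exp_der !coefwise_der_exp.
by rewrite coef0M !coef0_exp_der.
Qed.

(** Packed as a term rather than registered on [exp_der]: being a morphism
    depends on the Leibniz rule and on the characteristic, which [exp_der] does
    not mention. *)
Definition exp_morph : {rmorphism A -> {poly A}} :=
  HB.pack exp_der
    (GRing.isZmodMorphism.Build A {poly A} exp_der exp_der_zmod_morphism)
    (GRing.isMonoidMorphism.Build A {poly A} exp_der exp_der_monoid_morphism).

(** Chain rule for the extension of [exp(t D)] to [A[t]] that fixes [t]. *)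
Lemma deriv_flow p :
  (poly_eval exp_morph 'X p)^`() =
  poly_eval exp_morph 'X (p^`()) + poly_eval exp_morph 'X (coefwise_der p).
Proof.
elim/poly_ind: p => [|p c IHp].
  by rewrite -polyC0 coefwise_derC !linear0 !rmorph0 derivC addr0.
rewrite coefwise_derD coefwise_derM coefwise_derX coefwise_derC mulr0 addr0.
rewrite derivD derivM derivX derivC addr0 mulr1 !rmorphD !rmorphM /=.
rewrite !(poly_evalX, poly_evalC).
rewrite derivD derivM derivX IHp deriv_exp_der.
rewrite -[exp_der (D c)]/(exp_morph (D c)); ring.
Qed.

Lemma coef0_flow p : (poly_eval exp_morph 'X p)`_0 = p`_0.
Proof.
elim/poly_ind: p => [|p c _]; first by rewrite rmorph0.
rewrite !rmorphD !rmorphM /= !(poly_evalX, poly_evalC) /=.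
by rewrite !coefD !coefMX coef0_exp_der coefC.
Qed.

(** [D] commutes with the multiplication by [y], so once an iterate of [a] is
    divisible by [y] all the following ones are. *)
Lemma exp_der_eqmod0 (y a : A) : D y = 0 -> eqmod y (D a) 0 ->
  eqmod y%:P (exp_der a) a%:P.
Proof.
move=> Dy0 [w]; rewrite add0r => Da; apply: eqmod_poly => -[|n].
  by rewrite coef0_exp_der coefC; apply: eqmod_refl.
rewrite coef_exp_der coefC iterSr Da; exists ((n.+1`!%:R : K)^-1 *: iter n D w).
rewrite add0r -scalerAr; congr (_ *: _); elim: n => //= n ->.
by rewrite DM Dy0 mul0r add0r.
Qed.

Lemma exp_der_eqmod1 (y a : A) : D y = 0 -> eqmod y (D (D a)) 0 ->
  eqmod y%:P (exp_der a) (a%:P + (D a)%:P * 'X).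
Proof.
move=> Dy0 [w]; rewrite add0r => DDa; apply: eqmod_poly => -[|[|n]];
  rewrite coefD coefMX !coefC /= ?add0r ?addr0.
- by rewrite coef0_exp_der; apply: eqmod_refl.
- by rewrite coef_exp_der (_ : 1`! = 1%N) // invr1 scale1r; apply: eqmod_refl.
rewrite coef_exp_der !iterSr DDa; exists ((n.+2`!%:R : K)^-1 *: iter n D w).
rewrite add0r -scalerAr; congr (_ *: _); elim: n => //= n ->.
by rewrite DM Dy0 mul0r add0r.
Qed.

End Exponential.


(** [exp(- t D)] inverts [exp(t D)]: the composite has derivative zero in [t],
    so it is constant, and its constant coefficient is [a]. *)
Lemma exp_morphN (K : fieldType) (A : comAlgType K) (D D' : {linear A -> A})
    (charK0 : [pchar K] =i pred0)
    (DM : forall a b : A, D (a * b) = D a * b + a * D b)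
    (DM' : forall a b : A, D' (a * b) = D' a * b + a * D' b)
    (Dnil : locally_nilpotent D) (Dnil' : locally_nilpotent D') :
  (forall a, D' a = - D a) -> forall a,
  poly_eval (exp_morph charK0 DM Dnil) 'X (exp_morph charK0 DM' Dnil' a) = a%:P.
Proof.
move=> D'E a.
set P := poly_eval _ _ (exp_der Dnil' a).
have dP : P^`() = 0.
  have flowN : coefwise_der D (exp_der Dnil' a) = - exp_der Dnil' (D' a).
    rewrite -coefwise_der_exp; apply/polyP=> i.
    by rewrite coefN !coef_coefwise_der /= D'E opprK.
  by rewrite deriv_flow (deriv_exp_der charK0) flowN rmorphN addrN.
have P0 : P`_0 = a by by rewrite coef0_flow coef0_exp_der.
rewrite -[LHS]/P; apply/polyP=> -[|n]; rewrite ?P0 coefC //=.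
by apply: (natr_regular charK0 (n := n)); rewrite -coef_deriv dP coef0.
Qed.

(** * Isomorphic polynomial rings give isomorphic cylinders *)

Section Cylinder.
Variables (K : comNzRingType) (A B : comAlgType K).
Variable g : {rmorphism {poly B} -> {poly A}}.
Hypothesis gK : forall k : K, g (alg_const B k)%:P = (alg_const A k)%:P.
Variables (R : comAlgType K) (p : {lrmorphism A -> R}) (r : R).

(** A point of the cylinder over [Spec A] is a morphism [A[t] -> R]; composing
    with [g] gives a morphism [B[t] -> R], whose restriction to [B] and value
    at [t] form a point of the cylinder over [Spec B]. *)
Definition pullback : B -> R := poly_eval p r \o g \o polyC.

HB.instance Definition _ := GRing.RMorphism.on pullback.

Lemma pullback_scalable : scalable pullback.
Proof.
apply: morph_scalable => k.
rewrite -[LHS]/(poly_eval p r (g (alg_const B k)%:P)) gK poly_evalC.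
exact: lrmorph_const.
Qed.

Definition pullback_alg : {lrmorphism B -> R} :=
  HB.pack_for {lrmorphism B -> R} pullback
    (GRing.isScalable.Build K B R *:%R pullback pullback_scalable).

Definition cyl_map : {lrmorphism B -> R} * R :=
  (pullback_alg, poly_eval p r (g 'X)).

Lemma cyl_mapE : poly_eval cyl_map.1 cyl_map.2 =1 poly_eval p r \o g.
Proof.
by apply: poly_morph_ext => [b|]; [exact: poly_evalC|exact: poly_evalX].
Qed.

End Cylinder.

(** [f] and [g] have to respect the scalars of [K] only, and need not fix [A] or
    the variable. *)
Lemma cylinder_iso (K : comNzRingType) (A B : comAlgType K)
    (f : {rmorphism {poly A} -> {poly B}})
    (g : {rmorphism {poly B} -> {poly A}}) :
  (forall k : K, f (alg_const A k)%:P = (alg_const B k)%:P) ->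
  cancel f g -> cancel g f ->
  kiso (kprod (Spec A) affine_line) (kprod (Spec B) affine_line).
Proof.
move=> fK fgK gfK.
have gK (k : K) : g (alg_const B k)%:P = (alg_const A k)%:P by rewrite -fK fgK.
have inv (A' B' : comAlgType K) (u : {rmorphism {poly A'} -> {poly B'}})
    (v : {rmorphism {poly B'} -> {poly A'}})
    (uK : forall k : K, u (alg_const A' k)%:P = (alg_const B' k)%:P)
    (vK : forall k : K, v (alg_const B' k)%:P = (alg_const A' k)%:P)
    (R : comAlgType K) : cancel u v ->
    cancel (fun q : {lrmorphism A' -> R} * R => cyl_map vK q.1 q.2)
           (fun q => cyl_map uK q.1 q.2).
  move=> uvK [p r]; set q := cyl_map vK _ _.
  have qE := cyl_mapE vK p r; congr pair; last first.
    by rewrite -[LHS]/(poly_eval q.1 q.2 (u 'X)) qE /comp uvK poly_evalX.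
  apply: lrmorphism_ext => a.
  by rewrite -[LHS]/(poly_eval q.1 q.2 (u a%:P)) qE /comp uvK poly_evalC.
exists (fun R q => cyl_map gK q.1 q.2); split=> [R|R S phi [p r]].
  exists (fun q => cyl_map fK q.1 q.2); exact: inv.
have phiE : poly_eval (spec_map phi p) (phi r) =1 phi \o poly_eval p r.
  by apply: poly_morph_ext => [a|] /=; rewrite ?poly_evalC ?poly_evalX.
congr pair; last exact: phiE.
by apply: lrmorphism_ext => b; apply: phiE.
Qed.

(** * Affine modifications with isomorphic cylinders *)

Lemma polyC_regular (A : comNzRingType) (y : A) :
  (forall a, y * a = 0 -> a = 0) ->
  forall p q : {poly A}, y%:P * p = y%:P * q -> p = q.
Proof.
move=> yreg p q pq.
apply/polyP=> i; apply/eqP; rewrite -subr_eq0; apply/eqP/yreg.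
by rewrite mulrBr -!coefCM pq subrr.
Qed.

(** [C] is the affine modification [A[x/y]]: [iota_loc] says that it lies in
    [A[1/y]], and [univ] is its universal property, stated without uniqueness
    because [iota_loc] already gives that into rings where [y] is regular.
    Modulo [y], [exp(t D)] maps [x] to [x + t D x] and fixes [q], the inverse of
    [D x]. *)
Lemma modification_cylinder (K : fieldType) (A C : comAlgType K)
    (iota : {lrmorphism A -> C}) (x y q : A) (D : {linear A -> A})
    (charK0 : [pchar K] =i pred0)
    (iota_inj : injective iota)
    (yreg : forall c, iota y * c = 0 -> c = 0)
    (iota_loc : forall c, exists n a, iota y ^+ n * c = iota a)
    (x_div : exists x', iota x = iota y * x')
    (univ : forall (S : comNzRingType) (f : {rmorphism A -> S}),
       (exists s, f x = f y * s) ->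
       exists f' : {rmorphism C -> S}, forall a, f' (iota a) = f a)
    (DM : forall a b, D (a * b) = D a * b + a * D b)
    (Dnil : locally_nilpotent D)
    (Dy : D y = 0) (Dq : eqmod y (D q) 0) (DDx : eqmod y (D (D x)) 0)
    (qDx : eqmod y (q * D x) 1) :
  kiso (kprod (Spec C) affine_line) (kprod (Spec A) affine_line).
Proof.
(* [E] is exp(t D) and [E'] is exp(- t D). *)
have DM' (a b : A) : (\- D) (a * b) = (\- D) a * b + a * (\- D) b.
  by rewrite /= DM mulNr mulrN opprD.
have Dnil' : locally_nilpotent (\- D).
  move=> a; have [n Dna] := Dnil a; exists n.
  have -> : iter n (\- D) a = (-1) ^+ n *: iter n D a.
    elim: n {Dna} => [|n /= ->]; first by rewrite expr0 scale1r.
    by rewrite linearZ exprS mulN1r scaleNr.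
  by rewrite Dna scaler0.
have yregA (a : A) : y * a = 0 -> a = 0.
  move=> ya0; apply: iota_inj; rewrite rmorph0; apply: yreg.
  by rewrite -rmorphM ya0 rmorph0.
pose E := exp_morph charK0 DM Dnil; pose E' := exp_morph charK0 DM' Dnil'.
have Econst a : D a = 0 -> E a = a%:P by exact: exp_der_const.
have E'const a : D a = 0 -> E' a = a%:P.
  by move=> Da; apply: exp_der_const; rewrite /= Da oppr0.
have EE' a : poly_eval E 'X (E' a) = a%:P.
  by apply: exp_morphN => b.
have E'E a : poly_eval E' 'X (E a) = a%:P.
  by apply: exp_morphN => b; rewrite /= opprK.
have [w1 Ex] : eqmod y%:P (E x) (x%:P + (D x)%:P * 'X) by exact: exp_der_eqmod1.
have [w2 E'x] : eqmod y%:P (E' x) (x%:P + (- D x)%:P * 'X).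
  apply: (exp_der_eqmod1 DM' Dnil'); rewrite /= ?Dy ?oppr0 //.
  case: DDx => w; rewrite add0r => DDx; exists w.
  by rewrite add0r /= raddfN opprK.
have [w3 E'q] : eqmod y%:P (E' q) q%:P.
  apply: (exp_der_eqmod0 DM' Dnil'); rewrite /= ?Dy ?oppr0 //.
  by case: Dq => w; rewrite add0r => Dq; exists (- w); rewrite /= Dq; ring.
clearbody E E'.
have Ey := Econst y Dy; have E'y := E'const y Dy.
(* The automorphism t |-> t - q x of A[t], followed by t |-> y t. *)
pose T : {rmorphism {poly A} -> {poly A}} :=
  poly_eval polyC (y%:P * 'X - (q * x)%:P).
have TC a : T a%:P = a%:P by exact: poly_evalC.
have TX : T 'X = y%:P * 'X - (q * x)%:P by exact: poly_evalX.
clearbody T.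
have [w0 qDx1] := qDx.
(* T (E x) = x + D x * (y t - q x) modulo y, and q * D x = 1 modulo y, so y
   divides it. *)
have [beta0 beta0E] : exists f : {rmorphism C -> {poly A}},
    forall a, f (iota a) = T (E a).
  apply: (univ {poly A} (T \o E)).
  exists ((D x)%:P * 'X - x%:P * w0%:P + T w1).
  have qx : (q * D x)%:P = 1 + y%:P * w0%:P :> {poly A}.
    by rewrite qDx1 rmorphD rmorphM rmorph1.
  rewrite /= Ex Ey !rmorphD !rmorphM /= !TC TX.
  have -> : (D x)%:P * (y%:P * 'X - (q * x)%:P) =
     y%:P * (D x)%:P * 'X - x%:P * (q * D x)%:P.
    by rewrite !rmorphM /=; ring.
  by rewrite qx; ring.
pose beta : {rmorphism {poly C} -> {poly A}} :=
  poly_eval beta0 (y%:P * 'X - (q * x)%:P).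
have yregP := polyC_regular yreg; have yregPA := polyC_regular yregA.
(* E' (t + q x) = t + q (x - t * D x) = q x modulo y, and y divides x in C. *)
have [s sE] : exists s : {poly C},
    (iota y)%:P * s = map_poly iota ('X + E' (q * x)).
  have [x' xE] := x_div.
  have [w4 ->] : eqmod y%:P ('X + E' (q * x)) (q * x)%:P.
    exists (- w0%:P * 'X + q%:P * w2 + w3 * E' x).
    rewrite rmorphM E'q mulrDl E'x.
    have qx : (q * D x)%:P = 1 + y%:P * w0%:P :> {poly A}.
      by rewrite qDx1 rmorphD rmorphM rmorph1.
    have -> : q%:P * (x%:P + (- D x)%:P * 'X + y%:P * w2) =
      (q * x)%:P - (q * D x)%:P * 'X + q%:P * (y%:P * w2).
      by rewrite !rmorphM /= rmorphN; ring.
    by rewrite qx rmorphM; ring.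
  exists ((iota q * x')%:P + map_poly iota w4).
  have -> : map_poly iota ((q * x)%:P + y%:P * w4) =
      (iota q * iota x)%:P + (iota y)%:P * map_poly iota w4.
    rewrite rmorphD /= map_polyC /= (rmorphM iota); congr (_ + _).
    by rewrite rmorphM /= map_polyC.
  by rewrite xE mulrDr -polyCM mulrCA.
have betaC c : beta c%:P = beta0 c by exact: poly_evalC.
have betaX : beta 'X = y%:P * 'X - (q * x)%:P by exact: poly_evalX.
pose gamma : {rmorphism {poly A} -> {poly C}} :=
  poly_eval (map_poly iota \o E') s.
have gammaC a : gamma a%:P = map_poly iota (E' a) by exact: poly_evalC.
have gammaX : gamma 'X = s by exact: poly_evalX.
clearbody beta gamma.
(* Up to the inclusion of A[t] in C[t], [gamma] inverts T E and [beta] inverts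
   E' with t fixed; on A[t] the two compositions are identities because E and
   E' are inverse to each other. *)
have gammaT p : gamma (T p) = map_poly iota (poly_eval E' 'X p).
  pose u : {rmorphism _ -> _} := gamma \o T.
  pose v : {rmorphism _ -> _} := map_poly iota \o poly_eval E' 'X.
  apply: (poly_morph_ext (f := u) (g := v)) => [a|] /=.
    by rewrite TC gammaC poly_evalC.
  rewrite TX rmorphB rmorphM /= !gammaC gammaX poly_evalX /= E'y map_polyC /=.
  by rewrite sE rmorphD /= map_polyX addrK.
have betaiota p : beta (map_poly iota p) = T (poly_eval E 'X p).
  pose u : {rmorphism _ -> _} := beta \o map_poly iota.
  pose v : {rmorphism _ -> _} := T \o poly_eval E 'X.
  apply: (poly_morph_ext (f := u) (g := v)) => [a|] /=.
    by rewrite map_polyC /= betaC beta0E poly_evalC.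
  by rewrite map_polyX betaX poly_evalX.
apply: (cylinder_iso (f := beta) (g := gamma)).
- move=> k; rewrite betaC -(lrmorph_const iota) beta0E.
  by rewrite Econst ?TC // (derivation_const DM).
- pose u : {rmorphism _ -> _} := gamma \o beta.
  apply: (poly_morph_ext (f := u) (g := idfun)) => [c|] /=; last first.
    by rewrite betaX -TX gammaT poly_evalX map_polyX.
  rewrite betaC; have [n [a ca]] := iota_loc c.
  have main : (iota y)%:P ^+ n * gamma (beta0 c) = (iota y)%:P ^+ n * c%:P.
    have fixA b : gamma (beta0 (iota b)) = (iota b)%:P.
      by rewrite beta0E gammaT E'E map_polyC.
    have yn : (iota y)%:P ^+ n = (iota (y ^+ n))%:P by rewrite !rmorphXn.
    have yca : iota (y ^+ n) * c = iota a by rewrite rmorphXn.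
    rewrite yn -[in RHS]polyCM yca -(fixA (y ^+ n)).
    by rewrite -(rmorphM gamma) -(rmorphM beta0) yca fixA.
  by elim: n {ca} main => [|n IHn]; rewrite ?mul1r // !exprS -!mulrA => /yregP.
- pose u : {rmorphism _ -> _} := beta \o gamma.
  apply: (poly_morph_ext (f := u) (g := idfun)) => [a|] /=.
    by rewrite gammaC betaiota EE' TC.
  rewrite gammaX; apply: yregPA.
  have -> : y%:P * beta s = beta ((iota y)%:P * s).
    by rewrite rmorphM /= betaC beta0E Ey TC.
  rewrite sE betaiota rmorphD /= EE' poly_evalX rmorphD /= TC TX.
  by rewrite subrK.
Qed.

(** * Universal properties of quotients and localizations *)

Lemma quot_lift (K : comNzRingType) (A : comAlgType K) (hs : seq A)
    (hp : is_proper hs) (S : comNzRingType) (f : {rmorphism A -> S}) :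
  (forall a, a \in hs -> f a = 0) ->
  exists f' : {rmorphism quot_alg hp -> S}, forall a, f' (cls hp a) = f a.
Proof.
move=> f_hs; pose f' (c : quot_alg hp) : S := f (sval (cid (cls_surj c))).
have f'E a : f' (cls hp a) = f a.
  rewrite /f'; case: cid => b /= /eqP; rewrite -subr_eq0 -rmorphB => /eqP.
  move/cls_eq0=> [c ab]; apply/eqP; rewrite eq_sym -subr_eq0 -rmorphB ab.
  rewrite rmorph_sum /= big1 // => i _.
  by rewrite rmorphM (f_hs hs`_i) ?mulr0 // mem_nth.
have f'B : zmod_morphism f'.
  move=> c d; have [a ->] := cls_surj c; have [b ->] := cls_surj d.
  by rewrite -rmorphB !f'E rmorphB.
have f'M : monoid_morphism f'.
  split=> [|c d]; first by rewrite -(rmorph1 (cls hp)) f'E rmorph1.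
  have [a ->] := cls_surj c; have [b ->] := cls_surj d.
  by rewrite -rmorphM !f'E rmorphM.
pose F := HB.pack_for {rmorphism quot_alg hp -> S} f'
  (GRing.isZmodMorphism.Build _ _ f' f'B)
  (GRing.isMonoidMorphism.Build _ _ f' f'M).
by exists F.
Qed.

(** [S = A[s] / (y s - 1)].  If [a = w(s) (y s - 1)], comparing coefficients
    from the lowest gives [w_n = - y^n a], so [y^n a = 0] for large [n] and
    [a = 0]: thus [A] embeds, and in particular [1] is not in the ideal. *)
Lemma invert_regular (A : comNzRingType) (y : A) :
  (forall a, y * a = 0 -> a = 0) ->
  exists (S : comNzRingType) (j : {rmorphism A -> S}) (s : S),
    injective j /\ j y * s = 1.
Proof.
move=> yreg; pose d : {poly A} := y%:P * 'X - 1.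
have noC a : in_ideal [:: d] a%:P -> a = 0.
  move=> [c]; rewrite big_ord1 /=; set w : {poly A} := c _ => aE.
  have w0 : w`_0 = - a.
    move/(congr1 (fun p : {poly A} => p`_0)): aE.
    rewrite coefC mulrBr mulr1 coefB mulrA coefMX /= sub0r => ->.
    by rewrite opprK.
  have wS n : w`_n.+1 = y * w`_n.
    move/(congr1 (fun p : {poly A} => p`_n.+1)): aE.
    rewrite coefC mulrBr mulr1 coefB mulrA coefMX /= mulrC coefCM => /esym/eqP.
    by rewrite subr_eq0 => /eqP.
  have wn n : w`_n = - (y ^+ n * a).
    elim: n => [|n IHn]; first by rewrite mul1r.
    by rewrite wS IHn mulrN exprS mulrA.
  have := wn (size w); rewrite nth_default // => /esym/eqP.
  rewrite oppr_eq0 => /eqP; elim: (size w) => [|n IHn]; first by rewrite mul1r.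
  by rewrite exprS -mulrA => /yreg.
have dp : is_proper [:: d].
  by move=> /(noC 1) /eqP; rewrite oner_eq0.
exists (quot_alg dp : comNzRingType), (cls dp \o polyC), (cls dp 'X).
split=> [a b /= |].
  move/eqP; rewrite -subr_eq0 -rmorphB -polyCB => /eqP /cls_eq0 /noC /eqP.
  by rewrite subr_eq0 => /eqP.
rewrite /= -rmorphM -(rmorph1 (cls dp)); apply/eqP; rewrite -subr_eq0 -rmorphB.
by apply/eqP/cls_eq0; exists (fun=> 1); rewrite big_ord1 mul1r.
Qed.

(** * Algebras presented by relations in [x y^e], [y] and the [z]'s *)

Lemma ord_yz k (P : 'I_k.+1 -> Prop) :
  P ord0 -> (forall j, P (lift ord0 j)) -> forall i, P i.
Proof. by move=> P0 PS i; case: (unliftP ord0 i) => [j|] ->. Qed.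

Section Evaluation.
Variables (K : comNzRingType) (k : nat) (S : comNzRingType).
Variables (f : {rmorphism K -> S}) (a b : S) (zs : 'I_k -> S).

Definition eval_xyz : {mpoly K[k.+2]} -> S :=
  mmap f (tnth [tuple of a :: b :: [tuple zs j | j < k]]).

HB.instance Definition _ := GRing.RMorphism.on eval_xyz.

Lemma eval_xyzC c : eval_xyz c%:MP = f c.
Proof. exact: mmapC. Qed.

Lemma eval_xyzX : eval_xyz Xx = a.
Proof. by rewrite /eval_xyz /Xx mmapX mmap1U. Qed.

Lemma eval_xyzY : eval_xyz Xy = b.
Proof. by rewrite /eval_xyz /Xy mmapX mmap1U tnthS. Qed.

Lemma eval_xyzZ j : eval_xyz (Xz j) = zs j.
Proof. by rewrite /eval_xyz /Xz mmapX mmap1U !tnthS tnth_mktuple. Qed.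

End Evaluation.

Lemma eval_xyz_comp (K : comNzRingType) (k : nat) (S S' : comNzRingType)
    (j : {rmorphism S -> S'}) (f : {rmorphism K -> S}) a b (zs : 'I_k -> S) p :
  j (eval_xyz f a b zs p) = eval_xyz (j \o f) (j a) (j b) (j \o zs) p.
Proof.
apply: (mpoly_morph_ext (f := j \o eval_xyz f a b zs)) p => [c|] /=.
  by rewrite !eval_xyzC.
apply: ord_yz; last apply: ord_yz => [|i].
- by rewrite /= !eval_xyzX.
- by rewrite /= !eval_xyzY.
- by rewrite /= !eval_xyzZ.
Qed.

Lemma comp_mpoly_morph (K : comNzRingType) (n m : nat) (S : comNzRingType)
    (f : {rmorphism {mpoly K[m]} -> S}) (g : {rmorphism {mpoly K[n]} -> S})
    (lq : n.-tuple {mpoly K[m]}) :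
  (forall c, f c%:MP = g c%:MP) -> (forall i, f (tnth lq i) = g 'X_i) ->
  forall p, f (p \mPo lq) = g p.
Proof.
move=> fgC fgX; apply: (mpoly_morph_ext (f := f \o comp_mpoly lq)) => [c|i] /=.
  by rewrite comp_mpolyC.
by rewrite comp_mpolyXU -tnth_nth.
Qed.

(** The algebras of [h] and [htilde] are presented in the same way, with
    exponents [e = 2] and [e = 1]. *)
Section Presentation.
Variables (K : comNzRingType) (k l e : nat).
Variables (hbar hs : l.-tuple {mpoly K[k.+2]}).
Hypothesis hsE : forall j : 'I_l,
  tnth hs j = subst_x (Xx * Xy ^+ e) (tnth hbar j).
Variable hp : is_proper hs.

Let Q : comAlgType K := quot_alg hp.
Let x : Q := cls hp Xx.
Let y : Q := cls hp Xy.
Let z (j : 'I_k) : Q := cls hp (Xz j).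

Lemma cls_const c : cls hp c%:MP = alg_const Q c.
Proof. by rewrite -alg_mpolyC linearZ /= rmorph1. Qed.

Lemma presentation_ind (P : Q -> Prop) :
  (forall c, P (alg_const Q c)) -> P x -> P y -> (forall j, P (z j)) ->
  (forall a b, P a -> P b -> P (a + b)) ->
  (forall a b, P a -> P b -> P (a * b)) -> forall a, P a.
Proof.
move=> PC Px Py Pz PD PM a; have [p ->] := cls_surj a.
elim/mpoly_closed_ind: p => [c|i|p q Pp Pq|p q Pp Pq].
- by rewrite cls_const.
- by move: i; apply: ord_yz => //; apply: ord_yz.
- by rewrite rmorphD; apply: PD.
- by rewrite rmorphM; apply: PM.
Qed.

Lemma presentation_ext (S : comNzRingType) (f g : {rmorphism Q -> S}) :
  (forall c, f (alg_const Q c) = g (alg_const Q c)) -> f x = g x -> f y = g y ->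
  (forall j, f (z j) = g (z j)) -> f =1 g.
Proof.
move=> fgC fgx fgy fgz; elim/presentation_ind=> // a b fga fgb.
  by rewrite !rmorphD fga fgb.
by rewrite !rmorphM fga fgb.
Qed.

Lemma eval_subst (S : comNzRingType) (f : {rmorphism K -> S}) (a b : S)
    (zs : 'I_k -> S) p :
  eval_xyz f a b zs (subst_x (Xx * Xy ^+ e) p) =
  eval_xyz f (a * b ^+ e) b zs p.
Proof.
apply: comp_mpoly_morph => [c|]; first by rewrite /= !eval_xyzC.
apply: ord_yz; last apply: ord_yz => [|j].
- by rewrite tnth0 /= eval_xyzX rmorphM rmorphXn /= eval_xyzX eval_xyzY.
- by rewrite tnthS tnth0 /= !eval_xyzY.
- by rewrite !tnthS tnth_mktuple /= !eval_xyzZ.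
Qed.

Lemma cls_eval p : cls hp p = eval_xyz (@alg_const K Q) x y z p.
Proof.
apply: mpoly_morph_ext p => [c|]; first by rewrite [LHS]cls_const /= eval_xyzC.
apply: ord_yz; last apply: ord_yz => [|j].
- by rewrite /= eval_xyzX.
- by rewrite /= eval_xyzY.
- by rewrite /= eval_xyzZ.
Qed.

Lemma presentation_rel j :
  eval_xyz (@alg_const K Q) (x * y ^+ e) y z (tnth hbar j) = 0.
Proof.
rewrite -eval_subst -cls_eval -hsE; apply/cls_eq0.
exists (fun i => (i == j :> nat)%:R).
have jl : (j < size hs)%N by rewrite size_tuple.
rewrite (bigD1 (Ordinal jl)) //= eqxx mul1r big1 ?addr0 -?tnth_nth // => i.
by rewrite -val_eqE /= => /negPf ->; rewrite mul0r.
Qed.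

Lemma presentation_univ (S : comNzRingType) (f : {rmorphism K -> S}) (a b : S)
    (zs : 'I_k -> S) :
  (forall j, eval_xyz f (a * b ^+ e) b zs (tnth hbar j) = 0) ->
  exists F : {rmorphism Q -> S},
    [/\ forall c, F (alg_const Q c) = f c, F x = a, F y = b
      & forall j, F (z j) = zs j].
Proof.
move=> rel; have [|F FE] := quot_lift hp (f := eval_xyz f a b zs).
  by move=> p /tnthP[j ->]; rewrite hsE /= eval_subst.
exists F; split=> [c||| j]; rewrite ?FE.
- by rewrite -cls_const FE; apply: eval_xyzC.
- exact: eval_xyzX.
- exact: eval_xyzY.
- exact: eval_xyzZ.
Qed.

End Presentation.

(** * Two presentations with consecutive exponents *)

Section ConsecutiveExponents.
Variables (K : comNzRingType) (k l e : nat).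
Variables (hbar hs hs' : l.-tuple {mpoly K[k.+2]}).
Hypothesis hsE : forall j, tnth hs j = subst_x (Xx * Xy ^+ e.+1) (tnth hbar j).
Hypothesis hsE' :
  forall j, tnth hs' j = subst_x (Xx * Xy ^+ e.+2) (tnth hbar j).
Variables (hp : is_proper hs) (hp' : is_proper hs').

Let A : comAlgType K := quot_alg hp.
Let C : comAlgType K := quot_alg hp'.
Let x : A := cls hp Xx.
Let y : A := cls hp Xy.
Let z (j : 'I_k) : A := cls hp (Xz j).
Let x' : C := cls hp' Xx.
Let y' : C := cls hp' Xy.
Let z' (j : 'I_k) : C := cls hp' (Xz j).

Let relA j :
  eval_xyz (@alg_const K A) (x * y ^+ e.+1) y z (tnth hbar j) = 0.
Proof. exact: presentation_rel. Qed.

Let relC j :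
  eval_xyz (@alg_const K C) (x' * y' ^+ e.+2) y' z' (tnth hbar j) = 0.
Proof. exact: presentation_rel. Qed.

(** As [(x y) y^(e+1) = x y^(e+2)], the point [(x y, y, z)] of [C] satisfies the
    relations of [A]. *)
Lemma lower_morphism : exists f : {lrmorphism A -> C},
  [/\ f x = x' * y', f y = y' & forall j, f (z j) = z' j].
Proof.
have [j|f [fC fx fy fz]] := presentation_univ hsE hp (S := C)
    (f := @alg_const K C) (a := x' * y') (b := y') (zs := z').
  by rewrite -mulrA -exprS; apply: relC.
have [g gE] := alg_morph_of_rmorph fC.
by exists g; split=> [||j]; rewrite gE; [exact: fx|exact: fy|exact: fz].
Qed.

(** When [y] vanishes on both sides, so do [x y^(e+1)] and [x y^(e+2)], and the
    relations of [A] and of [C] become the same. *)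
Lemma y0_cylinder_iso : y = 0 -> y' = 0 ->
  kiso (kprod (Spec C) affine_line) (kprod (Spec A) affine_line).
Proof.
move=> y0 y0'.
have [j|f [fC fx fy fz]] := presentation_univ hsE' hp' (S := A)
    (f := @alg_const K A) (a := x) (b := y) (zs := z).
  by have := relA j; rewrite y0 !expr0n !mulr0.
have [j|g [gC gx gy gz]] := presentation_univ hsE hp (S := C)
    (f := @alg_const K C) (a := x') (b := y') (zs := z').
  by have := relC j; rewrite y0' !expr0n !mulr0.
have fK : cancel f g.
  apply: (presentation_ext (hp := hp') (f := g \o f) (g := idfun)) => //=.
  - by move=> c; rewrite fC gC.
  - by rewrite fx gx.
  - by rewrite fy gy.
  - by move=> j; rewrite fz gz.
have gK : cancel g f.
  apply: (presentation_ext (hp := hp) (f := f \o g) (g := idfun)) => //=.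
  - by move=> c; rewrite gC fC.
  - by rewrite gx fx.
  - by rewrite gy fy.
  - by move=> j; rewrite gz fz.
apply: (cylinder_iso (f := map_poly f) (g := map_poly g)).
- by move=> c; rewrite /= map_polyC /= fC.
- exact: map_polyK fK (rmorph0 g).
- exact: map_polyK gK (rmorph0 f).
Qed.

Variable iota : {lrmorphism A -> C}.
Hypotheses (iotax : iota x = x' * y') (iotay : iota y = y').
Hypothesis iotaz : forall j, iota (z j) = z' j.

(** If [y] is a combination of the relations of [C], setting [x = 0] makes it a
    combination of the [hbar_j(0, y, z)], which are multiples of [x y^(e+1)] in
    [A].  So [y (1 - x y^e w) = 0] in [A]; the second factor is not zero, as
    [iota] maps it to [1]. *)
Lemma y0_descends : (forall a b : A, a * b = 0 -> a = 0 \/ b = 0) ->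
  y' = 0 -> y = 0.
Proof.
move=> domA y0; have /cls_eq0[c Xyc] := y0.
pose ev : {rmorphism _ -> A} := eval_xyz (@alg_const K A) 0 y z.
have ev_hs j : eqmod (x * y ^+ e.+1) (ev (tnth hs' j)) 0.
  rewrite hsE' /= eval_subst mul0r -[X in eqmod _ _ X](relA j).
  apply: eqmod_mpoly => [a|]; first by rewrite /= !eval_xyzC.
  apply: ord_yz; last apply: ord_yz => [|i].
  - by exists (- 1); rewrite /= !eval_xyzX mulrN1 addrN.
  - by rewrite /= !eval_xyzY; apply: eqmod_refl.
  - by rewrite /= !eval_xyzZ; apply: eqmod_refl.
have [w] : eqmod (x * y ^+ e.+1) (ev Xy) 0.
  rewrite Xyc rmorph_sum /=.
  apply: eqmod_sum0 => i; rewrite rmorphM /=; apply: eqmod_mull0.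
  have il : (i < l)%N := leq_trans (ltn_ord i) (eq_leq (size_tuple hs')).
  by have := ev_hs (Ordinal il); rewrite (tnth_nth 0).
rewrite /= eval_xyzY add0r => yE.
have /domA[//|xw] : y * (1 - x * y ^+ e * w) = 0.
  by rewrite mulrBr mulr1 {1}yE exprS; ring.
have : iota 1 = 0.
  have -> : 1 = x * y ^+ e * w by apply/eqP; rewrite -subr_eq0 xw.
  by rewrite !rmorphM /= iotax y0 mulr0 !mul0r.
by move/eqP; rewrite rmorph1 oner_eq0.
Qed.

(** Over a ring in which [y] has an inverse [s], the point [(x s, y, z)]
    satisfies the relations of [C]; this defines a retraction of [iota] after
    inverting [y]. *)
Lemma lower_morphism_inj : (forall a, y * a = 0 -> a = 0) -> injective iota.
Proof.
move=> yreg; have [S [j [s [j_inj js]]]] := invert_regular yreg.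
have jxs : j x * s * j y ^+ e.+2 = j (x * y ^+ e.+1).
  by rewrite rmorphM rmorphXn -[RHS]mulr1 -js /= [in LHS]exprSr; ring.
have [i|F [FC Fx Fy Fz]] := presentation_univ hsE' hp' (S := S)
    (f := j \o @alg_const K A) (a := j x * s) (b := j y) (zs := j \o z).
  by rewrite jxs -eval_xyz_comp relA rmorph0.
have Fiota : F \o iota =1 j.
  apply: (presentation_ext (hp := hp)) => [c| | |i] /=.
  - by rewrite lrmorph_const FC.
  - by rewrite iotax rmorphM /= Fx Fy -mulrA [s * _]mulrC js mulr1.
  - by rewrite iotay Fy.
  - by rewrite iotaz Fz.
by move=> a b ab; apply: j_inj; rewrite -!Fiota /= ab.
Qed.

Lemma lower_morphism_loc (c : C) : exists n a, iota y ^+ n * c = iota a.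
Proof.
elim/presentation_ind: c => [c| | |j|a b|a b].
- by exists 0%N, (alg_const A c); rewrite mul1r lrmorph_const.
- by exists 1%N, x; rewrite expr1 iotay iotax mulrC.
- by exists 0%N, y; rewrite mul1r.
- by exists 0%N, (z j); rewrite mul1r iotaz.
- move=> [n [a' aE]] [m [b' bE]]; exists (n + m)%N.
  exists (y ^+ m * a' + y ^+ n * b').
  by rewrite rmorphD !rmorphM !rmorphXn /= -aE -bE exprD; ring.
- move=> [n [a' aE]] [m [b' bE]]; exists (n + m)%N, (a' * b').
  by rewrite rmorphM /= -aE -bE exprD; ring.
Qed.

Lemma lower_morphism_univ (S : comNzRingType) (f : {rmorphism A -> S}) :
  (exists s, f x = f y * s) ->
  exists f' : {rmorphism C -> S}, forall a, f' (iota a) = f a.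
Proof.
move=> [s fs]; have [j|F [FC Fx Fy Fz]] := presentation_univ hsE' hp' (S := S)
    (f := f \o @alg_const K A) (a := s) (b := f y) (zs := f \o z).
  have -> : s * f y ^+ e.+2 = f (x * y ^+ e.+1).
    by rewrite rmorphM rmorphXn /= fs exprS; ring.
  by rewrite -eval_xyz_comp relA rmorph0.
exists F.
apply: (presentation_ext (hp := hp) (f := F \o iota)) => [a| | |j] /=.
- by rewrite lrmorph_const FC.
- by rewrite iotax rmorphM Fx Fy -[RHS]/(f x) fs mulrC.
- by rewrite iotay Fy.
- by rewrite iotaz Fz.
Qed.

Lemma lower_morphism_of_yz (p : {mpoly K[k.+1]}) :
  iota (cls hp (of_yz p)) = cls hp' (of_yz p).
Proof.
pose u (T : {rmorphism {mpoly K[k.+2]} -> C}) : {rmorphism _ -> _} :=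
  T \o comp_mpoly [tuple of Xy :: [tuple Xz j | j < k]].
apply: (mpoly_morph_ext (f := u (iota \o cls hp)) (g := u (cls hp'))).
  by move=> c; rewrite /= comp_mpolyC !cls_const lrmorph_const.
apply: ord_yz => [|j] /=; rewrite comp_mpolyXU -tnth_nth.
  by rewrite tnth0; apply: iotay.
by rewrite tnthS tnth_mktuple; apply: iotaz.
Qed.

End ConsecutiveExponents.

(** Dividing by a kernel element [y] keeps local nilpotency because
    [delta^n = y^n D^n] on the subalgebra. *)
Lemma divide_derivation (K : comNzRingType) (A C : comAlgType K)
    (iota : {lrmorphism A -> C}) (y : A) (delta : C -> C) :
  injective iota -> (forall c, iota y * c = 0 -> c = 0) ->
  derivation delta -> locally_nilpotent delta -> delta (iota y) = 0 ->
  (forall a, exists b, delta (iota a) = iota y * iota b) ->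
  exists D : {linear A -> A},
    [/\ forall a, delta (iota a) = iota y * iota (D a),
        forall a b : A, D (a * b) = D a * b + a * D b & locally_nilpotent D].
Proof.
move=> iota_inj yreg [delta_lin deltaM] delta_lnd delta_y /choice[D0 D0E].
have yinj a b : iota y * iota a = iota y * iota b -> a = b.
  move=> /eqP; rewrite -subr_eq0 -mulrBr => /eqP /yreg /eqP.
  by rewrite subr_eq0 => /eqP /iota_inj.
have D0_lin : linear D0.
  move=> c a b; apply: yinj; rewrite -D0E !linearP /= mulrDr -scalerAr -!D0E.
  exact: delta_lin.
pose D : {linear A -> A} := HB.pack_for {linear A -> A} D0
  (GRing.isLinear.Build K A A *:%R D0 D0_lin).
have DE a : delta (iota a) = iota y * iota (D a) by exact: D0E.
exists D; clearbody D; clear D0 D0E D0_lin.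
have DM (a b : A) : D (a * b) = D a * b + a * D b.
  by apply: yinj; rewrite -DE rmorphM deltaM !DE rmorphD !rmorphM /=; ring.
have Dy : D y = 0.
  by apply: yinj; rewrite -DE delta_y rmorph0 mulr0.
split=> // a; have [n na] := delta_lnd (iota a); exists n; apply: iota_inj.
have iterE : iter n delta (iota a) = iota y ^+ n * iota (iter n D a).
  elim: n {na} => [|n /= ->]; first by rewrite mul1r.
  rewrite -rmorphXn -rmorphM DE DM.
  have -> : D (y ^+ n) = 0.
    elim: n => [|n IHn]; first by rewrite expr0 (derivation1 DM).
    by rewrite exprS DM Dy IHn mul0r mulr0 addr0.
  by rewrite mul0r add0r rmorphM rmorphXn exprS mulrA.
rewrite rmorph0; move: na; rewrite iterE; move: (iota (iter n D a)) => c.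
elim: n {iterE} => [|n IHn]; first by rewrite mul1r.
by rewrite exprS -mulrA => /yreg /IHn.
Qed.

(** * Conclusion *)

Theorem theorem4p6 (K : closedFieldType) (charK0 : [pchar K] =i pred0)
  (k l : nat) (h hbar : l.-tuple {mpoly K[k.+2]})
  (hE : forall j : 'I_l, tnth h j = subst_x (Xx * Xy ^+ 2) (tnth hbar j))
  (hp : is_proper h)
  (C := quot_alg hp : comAlgType K)
  (C_domain : GRing.integral_domain_axiom C)
  (x := cls hp Xx) (y := cls hp Xy) (z := fun j : 'I_k => cls hp (Xz j))
  (B := gen_subalg (fun c : C => c = y \/ exists j : 'I_k, c = z j))
  (delta : C -> C)
  (delta_der : derivation delta)
  (delta_lnd : locally_nilpotent delta)
  (delta_y : delta y = 0)
  (g : {mpoly K[k.+1]})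
  (delta_x : delta x = cls hp (of_yz g))
  (delta_x_ndiv : ~ divides y (delta x))
  (delta_z : forall j : 'I_k,
     B (delta (z j)) /\ exists b : C, B b /\ delta (z j) = y ^+ 2 * b)
  (htilde := [tuple subst_x (Xx * Xy) (tnth hbar j) | j < l])
  (htp : is_proper htilde)
  (Ctilde := quot_alg htp : comAlgType K)
  (Ctilde_domain : GRing.integral_domain_axiom Ctilde)
  (ghat := at_y0 g)
  (hhat := [tuple at_xy0 (tnth hbar j) | j < l])
  (Z := Spec C) (Y := Spec Ctilde)
  (ideal_full : forall p : {mpoly K[k]}, in_ideal (ghat :: hhat) p) :
  kiso (kprod Z affine_line) (kprod Y affine_line).
Proof.
pose xt : Ctilde := cls htp Xx; pose yt : Ctilde := cls htp Xy.
pose zt j : Ctilde := cls htp (Xz j).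
have htE j : tnth htilde j = subst_x (Xx * Xy ^+ 1) (tnth hbar j).
  by rewrite tnth_mktuple expr1.
have domC (a b : C) : a * b = 0 -> a = 0 \/ b = 0.
  by move/C_domain/orP=> [] /eqP; [left|right].
have domT (a b : Ctilde) : a * b = 0 -> a = 0 \/ b = 0.
  by move/Ctilde_domain/orP=> [] /eqP; [left|right].
have [iota [iotax iotay iotaz]] : exists f : {lrmorphism Ctilde -> C},
    [/\ f xt = x * y, f yt = y & forall j, f (zt j) = z j].
  exact: lower_morphism htE hE htp hp.
have [y0|/eqP yn0] := eqVneq y 0.
  apply: (y0_cylinder_iso htE hE _ y0).
  exact: (y0_descends htE hE iotax domT y0).
have yreg (c : C) : iota yt * c = 0 -> c = 0.
  by rewrite iotay => /domC[].
have iota_inj : injective iota.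
  apply: (lower_morphism_inj htE hE iotax iotay iotaz) => a.
  by move/domT=> [yt0|//]; case: yn0; rewrite -iotay [yt]yt0 rmorph0.
have iotaT := lower_morphism_of_yz iotay iotaz.
have [delta_lin deltaM] := delta_der.
have delta_const c : delta (alg_const C c) = 0.
  pose Delta : {linear C -> C} := HB.pack_for {linear C -> C} delta
    (GRing.isLinear.Build K C C *:%R delta delta_lin).
  exact: (derivation_const (D := Delta)).
have delta_zE j : exists b, delta (z j) = y ^+ 2 * iota b.
  have [_ [b [Bb ->]]] := delta_z j.
  have yz_image (c : C) : c = y \/ (exists j, c = z j) -> exists a, c = iota a.
    by move=> [->|[i ->]]; [exists yt|exists (zt i)].
  by have [b' ->] := gen_subalg_image yz_image Bb; exists b'.
have delta_div a : exists b, delta (iota a) = iota yt * iota b.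
  elim/presentation_ind: a => [c| | |j|a b|a b].
  - by exists 0; rewrite lrmorph_const delta_const rmorph0 mulr0.
  - exists (cls htp (of_yz g)).
    by rewrite iotax deltaM delta_y mulr0 addr0 delta_x iotaT iotay mulrC.
  - by exists 0; rewrite iotay delta_y rmorph0 mulr0.
  - rewrite iotaz; have [b ->] := delta_zE j.
    by exists (yt * b); rewrite rmorphM /= iotay; ring.
  - move=> [a' aE] [b' bE]; exists (a' + b').
    rewrite !rmorphD /= mulrDr -aE -bE.
    by have := delta_lin 1 (iota a) (iota b); rewrite !scale1r.
  - move=> [a' aE] [b' bE]; exists (a' * b + a * b').
    by rewrite rmorphM deltaM aE bE rmorphD !rmorphM /=; ring.
have delta_iotay : delta (iota yt) = 0 by rewrite iotay.
have [D [DE DM Dnil]] :=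
  divide_derivation iota_inj yreg delta_der delta_lnd delta_iotay delta_div.
have yinj a b : iota yt * iota a = iota yt * iota b -> a = b.
  move=> /eqP; rewrite -subr_eq0 -mulrBr => /eqP /yreg /eqP.
  by rewrite subr_eq0 => /eqP /iota_inj.
have Dy : D yt = 0 by apply: yinj; rewrite -DE delta_iotay rmorph0 mulr0.
have Dx : D xt = cls htp (of_yz g).
  apply: yinj; rewrite -DE iotax deltaM delta_y mulr0 addr0 delta_x iotaT iotay.
  by rewrite mulrC.
have Dz j : eqmod yt (D (zt j)) 0.
  have [b zE] := delta_zE j; exists b; rewrite add0r; apply: yinj.
  by rewrite -DE iotaz zE rmorphM /= iotay expr2 mulrA.
have DDx : eqmod yt (D (D xt)) 0.
  rewrite Dx; apply: (derivation_eqmod0 DM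
    (f := cls htp \o comp_mpoly [tuple of Xy :: [tuple Xz j | j < k]])).
    by move=> c; rewrite /= comp_mpolyC cls_const.
  apply: ord_yz => [|j] /=; rewrite comp_mpolyXU -tnth_nth.
    by rewrite tnth0 Dy; apply: eqmod_refl.
  by rewrite tnthS tnth_mktuple; apply: Dz.
(* Evaluation at z, the source of the inverse [psi (c ord0)] of g modulo y. *)
pose psi : {rmorphism {mpoly K[k]} -> Ctilde} := mmap (@alg_const K Ctilde) zt.
have psiC c : psi c%:MP = alg_const Ctilde c by exact: mmapC.
have psiX j : psi 'X_j = zt j by rewrite /psi /= mmapX mmap1U.
clearbody psi.
(* Modulo y, the coordinates (x y, y, z) of Ctilde are (0, 0, z). *)
have psi_ghat : eqmod yt (cls htp (of_yz g)) (psi ghat).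
  apply: (eqmod_mpoly
    (f := cls htp \o comp_mpoly [tuple of Xy :: [tuple Xz j | j < k]])
    (g := psi \o comp_mpoly [tuple of 0 :: [tuple 'X_j | j < k]])) => [c|] /=.
    by rewrite !comp_mpolyC cls_const psiC.
  apply: ord_yz => [|j]; rewrite !comp_mpolyXU -!tnth_nth.
    by rewrite !tnth0 rmorph0; exists 1; rewrite mulr1 add0r.
  by rewrite !tnthS !tnth_mktuple psiX; apply: eqmod_refl.
have psi_hhat i : eqmod yt (psi (tnth hhat i)) 0.
  rewrite tnth_mktuple -[X in eqmod _ _ X](presentation_rel htE htp i).
  apply: (eqmod_mpoly (f := psi \o
    comp_mpoly [tuple of 0 :: 0 :: [tuple 'X_j | j < k]])) => [c|] /=.
    by rewrite comp_mpolyC psiC eval_xyzC.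
  apply: ord_yz; last apply: ord_yz => [|j]; rewrite comp_mpolyXU -tnth_nth.
  - rewrite tnth0 rmorph0 eval_xyzX.
    by exists (- xt); rewrite mulrN mulrC addrN.
  - rewrite tnthS tnth0 rmorph0 eval_xyzY.
    by exists (- 1); rewrite mulrN1 addrN.
  - by rewrite !tnthS tnth_mktuple psiX eval_xyzZ; apply: eqmod_refl.
have [c one] := ideal_full 1.
refine (modification_cylinder (x := xt) (q := psi (c ord0)) charK0
  iota_inj yreg (lower_morphism_loc iotax iotay iotaz) _ _ DM Dnil Dy _ DDx _).
- by exists x; rewrite iotax iotay mulrC.
- exact: (lower_morphism_univ htE hE iotax iotay iotaz).
- by apply: derivation_eqmod0 => // j; rewrite psiX.
rewrite Dx; have [w ->] := psi_ghat.
have {}one : 1 =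
    c ord0 * ghat + \sum_(i < size hhat) c (lift ord0 i) * hhat`_i.
  by rewrite one big_ord_recl.
have [v vE] : eqmod yt (psi (\sum_(i < size hhat) c (lift ord0 i) * hhat`_i)) 0.
  rewrite rmorph_sum /=; apply: eqmod_sum0 => i; rewrite rmorphM.
  apply: eqmod_mull0.
  have il : (i < l)%N := leq_trans (ltn_ord i) (eq_leq (size_tuple hhat)).
  by have := psi_hhat (Ordinal il); rewrite (tnth_nth 0).
exists (psi (c ord0) * w - v); rewrite -(rmorph1 psi) one rmorphD rmorphM vE.
ring.
Qed.
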